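(* Assume $W_c$ satisfies Assumption 2, let $r>0$, and suppose $rH^{W_s}(M)+H^{W_c}(X|Z)<R$. Then \[ \liminf_{n\to\infty}-\frac1n\log P_j(\lfloor rn\rfloor,n)\ge\sup_{s\in(0,\frac12]}\frac{sR-U[W_s,W_c,\uparrow;r](s)}{1-s}. \]
   Context: Setup. $\mathcal M$ finite, $W_s$ an irreducible aperiodic transition matrix on $\mathcal M$; message $M^k$ with law $P_{M_1}(m_1)\prod_{i=2}^kW_s(m_i|m_{i-1})$. $\mathcal X$ a finite abelian group, $\mathcal Z$ finite, $W_c=\{W_c(x,z|x',z')\}$ an irreducible aperiodic transition matrix on $\mathcal X\times\mathcal Z$; noise $(X^n,Z^n)$ with law $P_{X_1Z_1}(x_1,z_1)\prod_{i=2}^nW_c(x_i,z_i|x_{i-1},z_{i-1})$. Channel: input $\tilde x^n$ yields output $(x^n,z^n)$ with probability $P_{X^nZ^n}(x^n-\tilde x^n,z^n)$. $P_j(k,n)$ is the minimum over codes $(\mathsf e:\mathcal M^k\to\mathcal X^n,\ \mathsf d:(\mathcal X\times\mathcal Z)^n\to\mathcal M^k)$ of the average decoding error probability. $R:=\log|\mathcal X|$. Assumption 2: either (i) for every $\theta\in(-\infty,1)$ and $z,z'$, $\sum_xW_c(x,z|x',z')^{1-\theta}$ does not depend on $x'$, or (ii) $|\mathcal Z|=1$; in either case $W_{c,Z}(z|z'):=\sum_xW_c(x,z|x',z')$ is independent of $x'$. Entrywise powers $a^t$ of transition probabilities are $0$ when $a=0$; $\lambda(A)$ denotes the Perron–Frobenius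 eigenvalue. $\theta H^{W_s}_{1-\theta}(M):=\log\lambda\big(W_s(m|m')^{1-\theta}\big)$. For transition matrices $V$ on $\mathcal Z$ with $V(z|z')>0$ whenever $W_{c,Z}(z|z')>0$: $H^{W_c|V}_{1-\theta}(X|Z):=\frac1\theta\log\lambda\big(W_c(x,z|x',z')^{1-\theta}V(z|z')^\theta\big)$, $H^{W_c,\uparrow}_{1-\theta}(X|Z):=\max_VH^{W_c|V}_{1-\theta}(X|Z)$, $H^{W_c,\downarrow}_{1-\theta}(X|Z):=H^{W_c|W_{c,Z}}_{1-\theta}(X|Z)$. $H^{W_s}(M):=\lim_{\theta\to0}H^{W_s}_{1-\theta}(M)$, $H^{W_c}(X|Z):=\lim_{\theta\to0}H^{W_c,\downarrow}_{1-\theta}(X|Z)$. $U[W_s,W_c,\uparrow;r](\theta):=r\theta H^{W_s}_{1-\theta}(M)+\theta H^{W_c,\uparrow}_{1-\theta}(X|Z)$. *)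

(* Defs.v *)
From Stdlib Require Import Reals ClassicalEpsilon.
From mathcomp Require Import all_boot ssralg finalg.
Set Implicit Arguments.
Unset Strict Implicit.
Unset Printing Implicit Defensive.
Local Open Scope R_scope.

Definition Rsup (S : R -> Prop) : R :=
  match excluded_middle_informative (exists l, is_lub S l) with
  | left h => proj1_sig (constructive_indefinite_description _ h)
  | right _ => 0
  end.
Definition Rinf (S : R -> Prop) : R := - Rsup (fun x => S (- x)).

Definition rsum {T : finType} (F : T -> R) : R := \big[Rplus/R0]_(i : T) F i.

Definition pw (a t : R) : R := if Req_EM_T a 0 then 0 else Rpower a t.

(* A "matrix" on T is A : T -> T -> R, with A i j = A(i|j). *)
Fixpoint mpow {T : finType} (A : T -> T -> R) (n : nat) : T -> T -> R :=
  match n with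
  | O => fun i j => if i == j then 1 else 0
  | S n' => fun i j => rsum (fun l => A i l * mpow A n' l j)
  end.

Definition is_dist {T : finType} (P : T -> R) : Prop :=
  (forall i, 0 <= P i) /\ rsum P = 1.

Definition is_trans {T : finType} (W : T -> T -> R) : Prop :=
  (forall i j, 0 <= W i j) /\ (forall j, rsum (fun i => W i j) = 1).

Definition irreducible {T : finType} (W : T -> T -> R) : Prop :=
  forall i j, exists n, (0 < n)%N /\ 0 < mpow W n i j.

Definition aperiodic {T : finType} (W : T -> T -> R) : Prop :=
  forall i d, (1 < d)%N ->
    exists n, (0 < n)%N /\ 0 < mpow W n i i /\ ~~ (d %| n)%N.

(* Perron--Frobenius eigenvalue: the largest eigenvalue admitting a
   nonnegative nonzero eigenvector (= spectral radius for A >= 0). *)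
Definition PFeig {T : finType} (A : T -> T -> R) : R :=
  Rsup (fun mu => exists v : T -> R,
          (forall i, 0 <= v i) /\ (exists i, v i <> 0) /\
          (forall i, rsum (fun j => A i j * v j) = mu * v i)).

Fixpoint chain {T : Type} (W : T -> T -> R) (prev : T) (s : seq T) : R :=
  match s with
  | [::] => 1
  | b :: t => W b prev * chain W b t
  end.
Definition mlaw {T : Type} (P0 : T -> R) (W : T -> T -> R) (s : seq T) : R :=
  match s with
  | [::] => 1
  | a :: t => P0 a * chain W a t
  end.

Section Channel.
Variables (M : finType) (X : finZmodType) (Z : finType).

(* noise realisation (x^n - xt^n, z^n) for output y = (x^n,z^n), input xt^n *)
Definition noise_of (y : seq (X * Z)) (xt : seq X) : seq (X * Z) :=
  [seq ((p.1.1 - p.2)%R, p.1.2) | p <- zip y xt].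

Definition err_prob (PM1 : M -> R) (Ws : M -> M -> R)
  (PXZ1 : X * Z -> R) (Wc : X * Z -> X * Z -> R) (k n : nat)
  (e : k.-tuple M -> n.-tuple X) (d : n.-tuple (X * Z) -> k.-tuple M) : R :=
  rsum (fun m : k.-tuple M =>
    mlaw PM1 Ws (tval m) *
    rsum (fun y : n.-tuple (X * Z) =>
      mlaw PXZ1 Wc (noise_of (tval y) (tval (e m))) *
      (if d y == m then 0 else 1))).

Definition Pj PM1 Ws PXZ1 Wc (k n : nat) : R :=
  Rinf (fun p => exists (e : k.-tuple M -> n.-tuple X)
                        (d : n.-tuple (X * Z) -> k.-tuple M),
                   p = err_prob PM1 Ws PXZ1 Wc e d).

(* W_{c,Z}(z|z') := sum_x W_c(x,z|x',z'), evaluated at x' = 0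
   (independent of x' under Assumption 2) *)
Definition WcZ (Wc : X * Z -> X * Z -> R) (z z' : Z) : R :=
  rsum (fun x : X => Wc (x, z) (0%R, z')).

Definition assumption2 (Wc : X * Z -> X * Z -> R) : Prop :=
  (forall theta, theta < 1 -> forall (z z' : Z) (x1 x2 : X),
     rsum (fun x : X => pw (Wc (x, z) (x1, z')) (1 - theta)) =
     rsum (fun x : X => pw (Wc (x, z) (x2, z')) (1 - theta)))
  \/ #|Z| = 1%N.

Definition HWs (Ws : M -> M -> R) (theta : R) : R :=
  / theta * ln (PFeig (fun m m' => pw (Ws m m') (1 - theta))).

Definition HcV (Wc : X * Z -> X * Z -> R) (theta : R) (V : Z -> Z -> R) : R :=
  / theta * ln (PFeig (fun p q : X * Z =>
                          pw (Wc p q) (1 - theta) * pw (V p.2 q.2) theta)).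

Definition Hup (Wc : X * Z -> X * Z -> R) (theta : R) : R :=
  Rsup (fun h => exists V : Z -> Z -> R,
          is_trans V /\ (forall z z', 0 < WcZ Wc z z' -> 0 < V z z') /\
          h = HcV Wc theta V).

Definition Hdown (Wc : X * Z -> X * Z -> R) (theta : R) : R :=
  HcV Wc theta (WcZ Wc).

(* U[W_s,W_c,up;r](theta) = r theta H^{W_s}_{1-theta}(M) + theta H^{up}_{1-theta} *)
Definition Uup (Ws : M -> M -> R) (Wc : X * Z -> X * Z -> R) (r theta : R) : R :=
  r * ln (PFeig (fun m m' => pw (Ws m m') (1 - theta))) + theta * Hup Wc theta.

End Channel.

Definition floor_nat (x : R) : nat := Z.to_nat (Int_part x).

(* Main.v *)
(* Random coding with uniform codewords and MAP decoding gives, with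
   [rho = s / (1 - s)], Gallager's bound on the error probability
     (sum_m P(m)^(1-s))^(1/(1-s)) * |X|^(-n rho) *
       sum_z (sum_x P(x,z)^(1-s))^(1/(1-s)).
   The first sum grows like the k-th power of lambda(Ws^(1-s)).  Assumption 2
   makes the inner sum over x a Markov-type product with matrix K on Z, up to
   a bounded factor, so the last sum grows like the n-th power of the
   Perron-Frobenius eigenvalue kappa of K^(1/(1-s)).  If g is the left
   eigenvector of that matrix, the choice
   V(z|z') = K(z|z')^(1/(1-s)) g(z) / (kappa g(z')) in the definition of
   H^up gives s H^up >= (1-s) ln kappa.  *)
Require Import Defs.
From Stdlib Require Import ZArith Reals Lra Lia ClassicalEpsilon.
From HB Require Import structures.
From mathcomp Require Import all_boot ssralg finalg.
Set Implicit Arguments.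
Unset Strict Implicit.
Unset Printing Implicit Defensive.
Local Open Scope R_scope.

(** * Finite sums *)

(** The range s <= 1/2 is exactly rho <= 1, which is what lets concavity of x ^ rho carry the
    average over codebooks inside the power. Strictly positive left eigenvectors do most of the
    spectral work. On a finite set such a vector is bounded below, so a multiple of it dominates the
    constant 1; path sums are then at most C * lambda ^ n with C independent of n, and C disappears
    after division by n. The same vectors evaluate [PFeig], a supremum of eigenvalues: pairing with
    a positive left eigenvector forces every nonnegative eigenvector to have the same eigenvalue.
    [Hup] enters the exponent with a minus sign, so a lower bound from a single V suffices and
    optimality of V is never proved. What must be proved is that the set defining [Hup] is bounded,
    since [Rsup] returns 0 otherwise. The power of |X| is a balance: uniform codewords contribute
    |X| ^ (-n/(1-s)), the sum over the x-part of the output contributes |X| ^ n, and the net factor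
    is |X| ^ (-n rho). *)

Lemma Rplus_assoc' : associative Rplus. Proof. by move=> x y z; ring. Qed.
Lemma Rplus_comm' : commutative Rplus. Proof. by move=> x y; ring. Qed.
Lemma Rplus_0_l' : left_id R0 Rplus. Proof. by move=> x; ring. Qed.
HB.instance Definition _ :=
  Monoid.isComLaw.Build R R0 Rplus Rplus_assoc' Rplus_comm' Rplus_0_l'.

Lemma Rmult_assoc' : associative Rmult. Proof. by move=> x y z; ring. Qed.
Lemma Rmult_comm' : commutative Rmult. Proof. by move=> x y; ring. Qed.
Lemma Rmult_1_l' : left_id R1 Rmult. Proof. by move=> x; ring. Qed.
HB.instance Definition _ :=
  Monoid.isComLaw.Build R R1 Rmult Rmult_assoc' Rmult_comm' Rmult_1_l'.

Lemma Rmult_0_l' : left_zero R0 Rmult. Proof. by move=> x; ring. Qed.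
Lemma Rmult_0_r' : right_zero R0 Rmult. Proof. by move=> x; ring. Qed.
HB.instance Definition _ := Monoid.isMulLaw.Build R R0 Rmult Rmult_0_l' Rmult_0_r'.

Lemma Rmult_plus_distr_l' : left_distributive Rmult Rplus.
Proof. by move=> x y z; ring. Qed.
Lemma Rmult_plus_distr_r' : right_distributive Rmult Rplus.
Proof. by move=> x y z; ring. Qed.
HB.instance Definition _ :=
  Monoid.isAddLaw.Build R Rmult Rplus Rmult_plus_distr_l' Rmult_plus_distr_r'.

Section FiniteSums.
Variable T : finType.
Implicit Types F G : T -> R.

Lemma eq_rsum F G : (forall i, F i = G i) -> rsum F = rsum G.
Proof. by move=> FG; apply: eq_bigr => i _; apply: FG. Qed.

Lemma rsum_ge0 F : (forall i, 0 <= F i) -> 0 <= rsum F.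
Proof.
move=> F0; rewrite /rsum.
by apply: (big_ind (fun x => 0 <= x)) => [|x y|i _]; [lra | lra | apply: F0].
Qed.

Lemma rsum_le F G : (forall i, F i <= G i) -> rsum F <= rsum G.
Proof.
move=> FG; rewrite /rsum.
by apply: (big_ind2 (fun x y => x <= y)) => [|x y z t|i _]; [lra | lra | apply: FG].
Qed.

Lemma rsum_mull a F : rsum (fun i => a * F i) = a * rsum F.
Proof. by rewrite /rsum big_distrr. Qed.

Lemma rsum_mulr a F : rsum (fun i => F i * a) = rsum F * a.
Proof. by rewrite /rsum big_distrl. Qed.

Lemma rsum_add F G : rsum (fun i => F i + G i) = rsum F + rsum G.
Proof. by rewrite /rsum big_split. Qed.

Lemma rsum_ge F i : (forall j, 0 <= F j) -> F i <= rsum F.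
Proof.
move=> F0; rewrite /rsum (bigD1 i) //=.
suff : 0 <= \big[Rplus/R0]_(j | j != i) F j by lra.
by apply: (big_ind (fun x => 0 <= x)) => [|x y|j _]; [lra | lra | apply: F0].
Qed.

Lemma rsum_gt0 F i : (forall j, 0 <= F j) -> 0 < F i -> 0 < rsum F.
Proof. by move=> F0 Fi; have := rsum_ge i F0; lra. Qed.

Lemma rsum_eq0 F i : (forall j, 0 <= F j) -> rsum F <= 0 -> F i = 0.
Proof. by move=> F0 S0; have := rsum_ge i F0; have := F0 i; lra. Qed.

Lemma rsum_gt0_ex F : (forall j, 0 <= F j) -> 0 < rsum F -> exists i, 0 < F i.
Proof.
move=> F0 S0; case: (classic (exists i, 0 < F i)) => // nex.
suff : rsum F <= 0 by lra.
rewrite (_ : 0 = rsum (fun _ : T => 0)); last by rewrite /rsum big1.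
apply: rsum_le => i; have := F0 i => Fi.
by case: (Rle_lt_dec (F i) 0) => // h; case: nex; exists i.
Qed.

Lemma rsum_const a : rsum (fun _ : T => a) = INR #|T| * a.
Proof.
rewrite /rsum big_const; elim: #|T| => [|n IH]; first by rewrite /=; ring.
by rewrite iterS IH S_INR; ring.
Qed.

Lemma finite_pos_lower F : (forall i, 0 < F i) -> exists2 d, 0 < d & forall i, d <= F i.
Proof.
move=> F0.
have [d d0 dP] : exists2 d, 0 < d & forall i, i \in enum T -> d <= F i.
  elim: (enum T) => [|a s [d d0 dP]]; first by exists 1 => //; lra.
  exists (Rmin d (F a)); first exact: Rmin_glb_lt.
  move=> i; rewrite inE => /orP[/eqP->|/dP]; first exact: Rmin_r.
  by have := Rmin_l d (F a); lra.
by exists d => // i; apply: dP; rewrite mem_enum.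
Qed.

Lemma finite_argmax (t0 : T) F : exists i, forall j, F j <= F i.
Proof.
have [i iP] : exists i, forall j, j \in enum T -> F j <= F i.
  elim: (enum T) => [|a s [i iP]]; first by exists t0.
  case: (Rle_lt_dec (F a) (F i)) => h; [exists i | exists a] => j.
    by rewrite inE => /orP[/eqP->|/iP].
  by rewrite inE => /orP[/eqP->|/iP]; lra.
by exists i => j; apply: iP; rewrite mem_enum.
Qed.

Lemma Un_cv_rsum (F : nat -> T -> R) (l : T -> R) :
  (forall i, Un_cv (fun n => F n i) (l i)) -> Un_cv (fun n => rsum (F n)) (rsum l).
Proof.
move=> cvF; rewrite /rsum !(big_mkcond predT) /=.
elim: (index_enum T) => [|a s IH].
  by rewrite big_nil => e e0; exists 0%N => n _; rewrite big_nil R_dist_eq.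
rewrite big_cons; move: (CV_plus _ _ _ _ (cvF a) IH) => h e e0.
by have [N NP] := h e e0; exists N => n /NP; rewrite big_cons.
Qed.

(** Bolzano-Weierstrass is applied to one coordinate at a time along [enum T], refining the previous
    extraction. Monotonicity of [phi] is not tracked: [n <= phi n] already preserves limits. *)
Lemma exists_bounded_subseq (x : nat -> T -> R) :
  (forall n i, 0 <= x n i <= 1) ->
  exists (phi : nat -> nat) (l : T -> R),
    (forall n, (n <= phi n)%coq_nat) /\ forall i, Un_cv (fun n => x (phi n) i) (l i).
Proof.
move=> xb.
suff [phi [l [phin cv]]] : exists (phi : nat -> nat) (l : T -> R),
    (forall n, (n <= phi n)%coq_nat) /\
    forall i, i \in enum T -> Un_cv (fun n => x (phi n) i) (l i).
  by exists phi, l; split=> // i; apply: cv; rewrite mem_enum.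
elim: (enum T) => [|a s [phi [l [phin cv]]]]; first by exists id, (fun=> 0).
have [la adh] : exists la, ValAdh (fun n => x (phi n) a) la.
  by apply: (Bolzano_Weierstrass _ _ (compact_P3 0 1)) => n; apply: xb.
have sel n : exists p, (n <= p)%coq_nat /\ Rabs (x (phi p) a - la) < / INR n.+1.
  have pos : 0 < / INR n.+1 by apply: Rinv_0_lt_compat; apply: lt_0_INR; apply/ltP.
  have [|p [np dp]] := adh (disc la (mkposreal _ pos)) n; last by exists p.
  by exists (mkposreal _ pos).
have [psi psiP] := choice _ sel.
exists (phi \o psi), (fun i => if i == a then la else l i); split=> [n|i].
  by apply: Nat.le_trans (phin _); case: (psiP n).
case: eqP => [-> _|/eqP ia].
  move=> e e0; have [N [Ne N0]] := archimed_cor1 e e0.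
  exists N => n nN /=; rewrite /R_dist; case: (psiP n) => _ h.
  have : / INR n.+1 <= / INR N.
    apply: Rinv_le_contravar; first exact: lt_0_INR.
    by apply: le_INR; apply: Nat.le_trans nN _; apply: Nat.le_succ_diag_r.
  by lra.
rewrite inE (negPf ia) /= => /cv cvi e e0; have [N NP] := cvi e e0.
exists N => n nN /=; apply: NP; case: (psiP n) => h _.
exact: (Nat.le_trans _ _ _ nN h).
Qed.

End FiniteSums.

Lemma rsum_exchange (S T : finType) (F : S -> T -> R) :
  rsum (fun i => rsum (fun j => F i j)) = rsum (fun j => rsum (fun i => F i j)).
Proof. exact: exchange_big. Qed.

(** * Perron-Frobenius theory *)

Section PerronFrobenius.
Variable T : finType.
Implicit Types (A : T -> T -> R) (v : T -> R).

Lemma mpow_ge0 A n i j : (forall i j, 0 <= A i j) -> 0 <= mpow A n i j.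
Proof.
move=> A0; elim: n i j => [|n IH] i j /=; first by case: eqP => _; lra.
by apply: rsum_ge0 => l; apply: Rmult_le_pos.
Qed.

Lemma mpow_comm A n i j :
  rsum (fun l => A i l * mpow A n l j) = rsum (fun l => mpow A n i l * A l j).
Proof.
elim: n i j => [|n IH] i j /=.
  rewrite /rsum (bigD1 j) //= eqxx big1 => [|l /negPf->]; last by ring.
  rewrite [RHS](bigD1 i) //= eqxx big1 => [|l]; first by ring.
  by rewrite eq_sym => /negPf->; ring.
transitivity (rsum (fun l => rsum (fun k => A i l * mpow A n l k * A k j))).
  apply: eq_rsum => l; rewrite IH -rsum_mull.
  by apply: eq_rsum => k; ring.
rewrite rsum_exchange; apply: eq_rsum => k.
by rewrite -rsum_mulr; apply: eq_rsum => l; ring.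
Qed.

(** [B] is the sum of the powers A^n for n < N, with N above one positive exponent for each pair of
    indices. A polynomial in A commutes with A. *)
Lemma irreducible_pos_commuting A :
  (forall i j, 0 <= A i j) -> irreducible A ->
  exists B : T -> T -> R, (forall i j, 0 < B i j) /\
    forall i j, rsum (fun l => A i l * B l j) = rsum (fun l => B i l * A l j).
Proof.
move=> A0 irrA.
have irr' (p : T * T) : exists n, 0 < mpow A n p.1 p.2.
  by have [n [_ h]] := irrA p.1 p.2; exists n.
have [nf nfP] := choice _ irr'.
pose N := (\max_(p : T * T) nf p).+1.
have ltN p : (nf p < N)%N by rewrite /N ltnS; apply: leq_bigmax.
exists (fun i j => rsum (fun n : 'I_N => mpow A n i j)); split=> i j.
  apply: (@rsum_gt0 _ _ (Ordinal (ltN (i, j)))) => [n|]; first exact: mpow_ge0.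
  exact: (nfP (i, j)).
transitivity (rsum (fun n : 'I_N => rsum (fun l => A i l * mpow A n l j))).
  by rewrite rsum_exchange; apply: eq_rsum => l; rewrite rsum_mull.
rewrite (eq_rsum (fun n : 'I_N => mpow_comm A n i j)) rsum_exchange.
by apply: eq_rsum => l; rewrite rsum_mulr.
Qed.

Lemma mulmv_gt0 (B : T -> T -> R) v i0 i :
  (forall i j, 0 < B i j) -> (forall i, 0 <= v i) -> 0 < v i0 ->
  0 < rsum (fun j => B i j * v j).
Proof.
move=> B0 v0 vi; apply: (@rsum_gt0 _ _ i0) => [j|]; last exact: Rmult_lt_0_compat.
by apply: Rmult_le_pos => //; apply: Rlt_le.
Qed.

(** These are the test pairs of the Collatz-Wielandt variational formula. The normalisation
    [rsum v = 1] keeps the vectors in a compact set. *)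
Definition subinvariant A (mu : R) v :=
  (forall i, 0 <= v i) /\ rsum v = 1 /\
  forall i, mu * v i <= rsum (fun j => A i j * v j).

Lemma subinvariant_le A mu v :
  (forall i j, 0 <= A i j) -> subinvariant A mu v ->
  mu <= rsum (fun i => rsum (fun j => A i j)).
Proof.
move=> A0 [v0 [v1 vA]].
have vle1 j : v j <= 1 by rewrite -v1; apply: rsum_ge.
rewrite -[mu]Rmult_1_r -v1 -rsum_mull; apply: rsum_le => i.
apply: Rle_trans (vA i) _; apply: rsum_le => j.
by have := A0 i j; have := vle1 j; have := v0 j; nra.
Qed.

(** The supremum [lam] is approached by vectors for [lam - / INR n.+1]; they lie in the unit cube,
    and a limit point inherits the closed conditions of [subinvariant], so the supremum is
    attained. *)
Lemma collatz_wielandt_max (t0 : T) A :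
  (forall i j, 0 <= A i j) ->
  exists lam v, subinvariant A lam v /\ forall mu w, subinvariant A mu w -> mu <= lam.
Proof.
move=> A0.
have [||lam [ub lub]] := completeness (fun mu => exists v, subinvariant A mu v).
- exists (rsum (fun i => rsum (fun j => A i j))) => mu [v]; exact: subinvariant_le.
- exists 0, (fun i => if i == t0 then 1 else 0); split=> [i|]; first by case: eqP; lra.
  split=> [|i]; first by rewrite /rsum -big_mkcond /= big_pred1_eq.
  rewrite Rmult_0_l; apply: rsum_ge0 => j.
  by apply: Rmult_le_pos => //; case: eqP; lra.
have sel n : exists v, subinvariant A (lam - / INR n.+1) v.
  apply: NNPP => no.
  have pos : 0 < / INR n.+1 by apply: Rinv_0_lt_compat; apply: lt_0_INR; apply/ltP.
  suff : lam <= lam - / INR n.+1 by lra.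
  apply: lub => mu [v [v0 [v1 vA]]].
  case: (Rle_lt_dec mu (lam - / INR n.+1)) => // lt; case: no; exists v.
  split=> //; split=> // i; apply: Rle_trans (vA i).
  by apply: Rmult_le_compat_r => //; lra.
have [x xP] := choice _ sel.
have [|phi [l [phin cv]]] := @exists_bounded_subseq _ x.
  move=> n i; have [x0 [x1 _]] := xP n; split=> //.
  by rewrite -x1; apply: rsum_ge.
have cvinv : Un_cv (fun n => lam - / INR (phi n).+1) lam.
  move=> e e0; have [N [Ne N0]] := archimed_cor1 e e0.
  exists N => n nN; rewrite /R_dist.
  have pos : 0 < / INR (phi n).+1 by apply: Rinv_0_lt_compat; apply: lt_0_INR; apply/ltP.
  have : / INR (phi n).+1 <= / INR N.
    apply: Rinv_le_contravar; first exact: lt_0_INR.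
    apply: le_INR; apply: Nat.le_trans nN _; apply: Nat.le_trans (phin n) _.
    exact: Nat.le_succ_diag_r.
  by rewrite Rabs_left; lra.
have cvc (c : R) : Un_cv (fun=> c) c by move=> e e0; exists 0%N => n _; rewrite R_dist_eq.
exists lam, l; split=> [|mu w mw]; last by apply: ub; exists w.
split=> [i|].
  by apply: (@Rle_cv_lim (fun=> 0) _ _ _ _ (cvc 0) (cv i)) => n; case: (xP (phi n)).
split=> [|i].
  apply: (UL_sequence _ _ _ (Un_cv_rsum cv)) => e e0; exists 0%N => n _.
  by have [_ [-> _]] := xP (phi n); rewrite R_dist_eq.
have cvA : Un_cv (fun n => rsum (fun j => A i j * x (phi n) j))
                 (rsum (fun j => A i j * l j)).
  apply: (@Un_cv_rsum _ (fun n j => A i j * x (phi n) j)) => j.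
  exact: (CV_mult _ _ _ _ (cvc (A i j)) (cv j)).
apply: (Rle_cv_lim _ (CV_mult _ _ _ _ cvinv (cv i)) cvA) => n.
by have [_ [_ h]] := xP (phi n); apply: h.
Qed.

(* If [A v - lam v] were nonzero at the Collatz-Wielandt maximum, a positive
   matrix commuting with [A] would turn it into a strictly positive vector, so
   that [lam] could be increased. *)
Lemma perron_frobenius (t0 : T) A :
  (forall i j, 0 <= A i j) -> irreducible A ->
  exists lam v, 0 < lam /\ (forall i, 0 < v i) /\
    forall i, rsum (fun j => A i j * v j) = lam * v i.
Proof.
move=> A0 irrA.
have [B [B0 BA]] := irreducible_pos_commuting A0 irrA.
have [lam [v [[v0 [v1 vA]] lmax]]] := collatz_wielandt_max t0 A0.
have [i0 vi0] : exists i, 0 < v i by apply: rsum_gt0_ex => //; lra.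
pose y i := rsum (fun j => B i j * v j).
have y0 i : 0 < y i by apply: (mulmv_gt0 _ B0 v0 vi0).
have Ay i : rsum (fun j => A i j * y j) =
            rsum (fun j => B i j * rsum (fun l => A j l * v l)).
  transitivity (rsum (fun l => rsum (fun j => A i j * B j l) * v l)).
    transitivity (rsum (fun j => rsum (fun l => A i j * B j l * v l))).
      by apply: eq_rsum => j; rewrite -rsum_mull; apply: eq_rsum => l; ring.
    by rewrite rsum_exchange; apply: eq_rsum => l; rewrite rsum_mulr.
  transitivity (rsum (fun l => rsum (fun j => B i j * A j l * v l))).
    by apply: eq_rsum => l; rewrite BA rsum_mulr.
  rewrite rsum_exchange; apply: eq_rsum => j.
  by rewrite -rsum_mull; apply: eq_rsum => l; ring.
pose d i := rsum (fun j => A i j * v j) - lam * v i.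
have d0 i : 0 <= d i by rewrite /d; have := vA i; lra.
have Ayd i : rsum (fun j => A i j * y j) = lam * y i + rsum (fun j => B i j * d j).
  rewrite Ay -rsum_mull -rsum_add; apply: eq_rsum => j; rewrite /d; ring.
have dz i : d i = 0.
  apply: NNPP => dn.
  have di : 0 < d i by have := d0 i; lra.
  (* With [dl] a positive lower bound of these ratios, A y >= (lam + dl) y. Normalising y by its sum
     contradicts the maximality of [lam]. *)
  pose q i := rsum (fun j => B i j * d j) / y i.
  have [|dl dl0 dlP] := @finite_pos_lower _ q.
    by move=> j; apply: Rdiv_lt_0_compat => //; apply: (mulmv_gt0 _ B0 d0 di).
  pose s := rsum y.
  have s0 : 0 < s by apply: (@rsum_gt0 _ _ i0) => // j; apply: Rlt_le.
  suff : lam + dl <= lam by lra.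
  apply: (lmax _ (fun j => y j * / s)); split=> [j|].
    by apply: Rlt_le; apply: Rmult_lt_0_compat => //; apply: Rinv_0_lt_compat.
  split=> [|j]; first by rewrite rsum_mulr -/s; field; lra.
  rewrite (@eq_rsum _ _ (fun k => A j k * y k * / s)) => [|k]; last by ring.
  rewrite rsum_mulr Ayd -Rmult_assoc; apply: Rmult_le_compat_r.
    by apply: Rlt_le; apply: Rinv_0_lt_compat.
  have -> : rsum (fun k => B j k * d k) = q j * y j by rewrite /q; field; have := y0 j; lra.
  by have := dlP j; have := y0 j; nra.
have Ey i : rsum (fun j => A i j * y j) = lam * y i.
  rewrite Ayd (@eq_rsum _ _ (fun=> 0)) => [|j]; last by rewrite dz; ring.
  by rewrite rsum_const; ring.
exists lam, y; split=> //.
(* If [lam] were not positive, A y = lam y with y > 0 would force A = 0, and no positive power of A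
   could have a positive diagonal entry. *)
apply: Rnot_le_lt => lam0.
have Az i j : A i j = 0.
  have : A i j * y j = 0.
    apply: (@rsum_eq0 _ (fun j => A i j * y j)) => [k|].
      by apply: Rmult_le_pos => //; apply: Rlt_le.
    by rewrite Ey; have := y0 i; nra.
  by have := y0 j => ? /Rmult_integral[]//; lra.
have [[|n] [//_ /=]] := irrA t0 t0.
by rewrite (@eq_rsum _ _ (fun=> 0)) => [|j]; [rewrite rsum_const; lra | rewrite Az; ring].
Qed.

Lemma mpow_trans A n i j : mpow (fun i j => A j i) n i j = mpow A n j i.
Proof.
elim: n i j => [|n IH] i j /=; first by rewrite eq_sym.
rewrite mpow_comm; apply: eq_rsum => l; rewrite IH; ring.
Qed.

Lemma perron_frobenius_left (t0 : T) A :
  (forall i j, 0 <= A i j) -> irreducible A ->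
  exists lam v, 0 < lam /\ (forall i, 0 < v i) /\
    forall j, rsum (fun i => v i * A i j) = lam * v j.
Proof.
move=> A0 irrA.
have [||lam [v [l0 [v0 vA]]]] := @perron_frobenius t0 (fun i j => A j i).
- by [].
- by move=> i j; have [n [n0 h]] := irrA j i; exists n; rewrite mpow_trans.
exists lam, v; do !split=> //; move=> j; rewrite -vA.
by apply: eq_rsum => i; ring.
Qed.

(** The double sum of u_i A_ij v_j equals both mu <u, v> and ka <u, v>, and <u, v> > 0. *)
Lemma left_right_eigenvalue A mu v ka u :
  (forall i, 0 < u i) -> (forall j, rsum (fun i => u i * A i j) = ka * u j) ->
  (forall i, 0 <= v i) -> (exists i, v i <> 0) ->
  (forall i, rsum (fun j => A i j * v j) = mu * v i) -> mu = ka.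
Proof.
move=> u0 uA v0 [i0 vi] vA.
have vi0 : 0 < v i0 by have := v0 i0; lra.
have uv : 0 < rsum (fun i => u i * v i).
  apply: (@rsum_gt0 _ _ i0) => [i|]; last exact: Rmult_lt_0_compat.
  by apply: Rmult_le_pos => //; apply: Rlt_le.
apply: (Rmult_eq_reg_r (rsum (fun i => u i * v i))); last by lra.
rewrite -!rsum_mull.
transitivity (rsum (fun i => rsum (fun j => u i * A i j * v j))).
  apply: eq_rsum => i.
  rewrite (_ : mu * _ = u i * (mu * v i)); last by ring.
  by rewrite -vA -rsum_mull; apply: eq_rsum => j; ring.
rewrite rsum_exchange; apply: eq_rsum => j; rewrite rsum_mulr uA; ring.
Qed.

Lemma Rsup_eq S l : is_lub S l -> Rsup S = l.
Proof.
move=> lubl; rewrite /Rsup; case: excluded_middle_informative => [h|[]]; last by exists l.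
by case: constructive_indefinite_description => x lubx /=; apply: (is_lub_u S).
Qed.

(** The set whose supremum is [PFeig A] is the singleton {ka}: the pairing argument leaves no other
    value, and [perron_frobenius] makes it nonempty. *)
Lemma PFeig_left A u ka :
  T -> (forall i j, 0 <= A i j) -> irreducible A ->
  (forall i, 0 < u i) -> (forall j, rsum (fun i => u i * A i j) = ka * u j) ->
  PFeig A = ka.
Proof.
move=> t0 A0 irrA u0 uA; apply: Rsup_eq; split=> [mu [v [v0 [vn vA]]]|b ub].
  by apply: Req_le; apply: left_right_eigenvalue vA.
have [lam [v [l0 [v0 vA]]]] := perron_frobenius t0 A0 irrA.
have vn : exists i, v i <> 0 by exists t0; have := v0 t0; lra.
have v0' i : 0 <= v i by apply: Rlt_le.
by apply: ub; exists v; rewrite -(left_right_eigenvalue u0 uA v0' vn vA).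
Qed.

Lemma PFeig_left_eigenvector (t0 : T) A :
  (forall i j, 0 <= A i j) -> irreducible A ->
  0 < PFeig A /\ exists u, (forall i, 0 < u i) /\
    forall j, rsum (fun i => u i * A i j) = PFeig A * u j.
Proof.
move=> A0 irrA; have [lam [v [l0 [v0 vA]]]] := perron_frobenius_left t0 A0 irrA.
by rewrite (PFeig_left t0 A0 irrA v0 vA); split=> //; exists v.
Qed.

(** Summing the eigenvector equation over i compares mu with the column sums. The assumption
    [0 <= b] covers the default value 0 of [Rsup]. This bound holds uniformly in V when [Hup] is
    shown to be a genuine supremum. *)
Lemma PFeig_le A b :
  0 <= b -> (forall j, rsum (fun i => A i j) <= b) -> PFeig A <= b.
Proof.
move=> b0 Ab; rewrite /PFeig /Rsup.
case: excluded_middle_informative => // h.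
case: constructive_indefinite_description => x /= [_]; apply=> mu [v [v0 [[i0 vi] vA]]].
have s0 : 0 < rsum v by apply: (@rsum_gt0 _ _ i0) => //; have := v0 i0; lra.
apply: (Rmult_le_reg_r (rsum v)) => //; rewrite -!rsum_mull.
rewrite -(eq_rsum vA) rsum_exchange; apply: rsum_le => j.
by rewrite rsum_mulr; apply: Rmult_le_compat_r.
Qed.

End PerronFrobenius.

(** Paths of positive weight for W are carried by [f] to paths of positive weight for L, and [g]
    lifts the prescribed endpoints. It serves both for entrywise powers (f the identity) and for the
    projection of X * Z to Z. *)
Lemma irreducible_image (S T : finType) (f : S -> T) (g : T -> S)
    (W : S -> S -> R) (L : T -> T -> R) :
  cancel g f -> (forall p q, 0 <= W p q) -> (forall i j, 0 <= L i j) ->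
  (forall p q, 0 < W p q -> 0 < L (f p) (f q)) ->
  irreducible W -> irreducible L.
Proof.
move=> gK W0 L0 WL irrW.
have step n p q : 0 < mpow W n p q -> 0 < mpow L n (f p) (f q).
  elim: n p q => [|n IH] p q /=.
    by case: (p =P q) => [->|_]; [rewrite eqxx | lra].
  have W0' l : 0 <= W p l * mpow W n l q by apply: Rmult_le_pos => //; apply: mpow_ge0.
  move/(rsum_gt0_ex W0') => [l Wl].
  have Wpl : 0 < W p l.
    by have := W0 p l; case=> // e; move: Wl; rewrite -e Rmult_0_l; lra.
  apply: (@rsum_gt0 _ _ (f l)) => [i|].
    by apply: Rmult_le_pos => //; apply: mpow_ge0.
  apply: Rmult_lt_0_compat; first exact: WL.
  by apply: IH; apply: (Rmult_lt_reg_l (W p l)) => //; lra.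
move=> i j; have [n [n0 h]] := irrW (g i) (g j).
by exists n; split=> //; have := step _ _ _ h; rewrite !gK.
Qed.

(** * Powers and Gallager's random coding bound *)

Section Powers.
Implicit Types a b s t : R.

Lemma pw0 t : pw 0 t = 0.
Proof. by rewrite /pw; case: (Req_EM_T 0 0). Qed.

Lemma pw_gt0 a t : 0 < a -> 0 < pw a t.
Proof. by move=> a0; rewrite /pw; case: (Req_EM_T a 0) => h /=; [lra | exact: exp_pos]. Qed.

Lemma pw_ge0 a t : 0 <= pw a t.
Proof. by rewrite /pw; case: (Req_EM_T a 0) => h /=; [lra | apply: Rlt_le; exact: exp_pos]. Qed.

Lemma pwE a t : 0 < a -> pw a t = exp (t * ln a).
Proof. by move=> a0; rewrite /pw; case: (Req_EM_T a 0) => h //=; lra. Qed.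

Lemma pw_mul a b t : 0 <= a -> 0 <= b -> pw (a * b) t = pw a t * pw b t.
Proof.
case=> [a0|<-]; last by rewrite Rmult_0_l pw0; lra.
case=> [b0|<-]; last by rewrite Rmult_0_r pw0; lra.
rewrite !pwE //; last exact: Rmult_lt_0_compat.
by rewrite ln_mult // -exp_plus; congr exp; ring.
Qed.

Lemma pw_add a s t : 0 <= a -> pw a (s + t) = pw a s * pw a t.
Proof.
case=> [a0|<-]; last by rewrite !pw0; lra.
by rewrite !pwE // -exp_plus; congr exp; ring.
Qed.

Lemma pw_pw a s t : 0 <= a -> pw (pw a s) t = pw a (s * t).
Proof.
case=> [a0|<-]; last by rewrite !pw0.
rewrite [LHS]pwE; last exact: pw_gt0.
by rewrite !pwE // ln_exp; congr exp; ring.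
Qed.

Lemma pw1 a : 0 <= a -> pw a 1 = a.
Proof. by case=> [a0|<-]; [rewrite pwE // Rmult_1_l exp_ln | rewrite pw0]. Qed.

Lemma one_pw t : pw 1 t = 1.
Proof. by rewrite pwE; [rewrite ln_1 Rmult_0_r exp_0 | lra]. Qed.

Lemma pw_inv a t : 0 < a -> pw (/ a) t = / pw a t.
Proof.
move=> a0; have := pw_gt0 t a0 => ?.
apply: (Rmult_eq_reg_r (pw a t)); last by lra.
rewrite -pw_mul; try lra; last by apply: Rlt_le; apply: Rinv_0_lt_compat.
by rewrite !Rinv_l ?one_pw //; lra.
Qed.

Lemma ln_le a b : 0 < a -> a <= b -> ln a <= ln b.
Proof. by move=> a0 [/(ln_increasing _ _ a0)|->]; lra. Qed.

Lemma ln_nonpos a : a <= 0 -> ln a = 0.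
Proof. by rewrite /ln; case: (Rlt_dec 0 a) => h a0 //; exfalso; lra. Qed.

Lemma pw_le a b t : 0 <= t -> 0 <= a <= b -> pw a t <= pw b t.
Proof.
move=> t0 [[a0|<-] ab]; last by rewrite pw0; apply: pw_ge0.
have le : t * ln a <= t * ln b by apply: Rmult_le_compat_l => //; apply: ln_le.
by rewrite !pwE; try lra; case: le => [/exp_increasing|->]; lra.
Qed.

Lemma ln_pw a t : 0 < a -> ln (pw a t) = t * ln a.
Proof. by move=> a0; rewrite pwE // ln_exp. Qed.

(** The tangent of the concave power at 1. With x = ln a, the bound 1 + y <= exp y is used at y =
    (1-t)x and y = -tx; the weights t and 1-t cancel the linear terms. *)
Lemma pw_le_tangent a t : 0 < t <= 1 -> 0 <= a -> pw a t <= 1 - t + t * a.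
Proof.
move=> t01 [a0|<-]; last by rewrite pw0; lra.
rewrite pwE //; set x := ln a; have -> : a = exp x by rewrite /x exp_ln.
have e1 := exp_ineq1_le ((1 - t) * x); have e2 := exp_ineq1_le (- (t * x)).
have p0 := exp_pos (t * x).
have e3 : exp (t * x) * exp (- (t * x)) = 1 by rewrite -exp_plus Rplus_opp_r exp_0.
have e4 : exp (t * x) * exp ((1 - t) * x) = exp x by rewrite -exp_plus; congr exp; ring.
rewrite -e4.
have : 0 <= exp (t * x) * ((1 - t) * exp (- (t * x)) + t * exp ((1 - t) * x) - 1).
  by apply: Rmult_le_pos; nra.
have -> : exp (t * x) * ((1 - t) * exp (- (t * x)) + t * exp ((1 - t) * x) - 1) =
    (1 - t) * (exp (t * x) * exp (- (t * x))) +
    t * (exp (t * x) * exp ((1 - t) * x)) - exp (t * x) by ring.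
by rewrite e3; lra.
Qed.

(* Jensen for the concave [T |-> T ^ t], with the normalisation of the weights
   moved to the right so that [H = 0] is allowed. *)
Lemma rsum_pw_concave (I : finType) (w F : I -> R) (H tau t : R) :
  0 < t <= 1 -> (forall i, 0 <= w i) -> (forall i, 0 <= F i) -> 0 <= tau ->
  rsum w = H -> rsum (fun i => w i * F i) <= H * tau ->
  rsum (fun i => w i * pw (F i) t) <= H * pw tau t.
Proof.
move=> t01 w0 F0 [tau0|<-] wH wF.
  have H0 : 0 <= H by rewrite -wH; apply: rsum_ge0.
  have p0 := pw_gt0 t tau0.
  have pt i : w i * pw (F i) t <=
      pw tau t * ((1 - t) * w i + t * / tau * (w i * F i)).
    have -> : F i = tau * (F i * / tau) by field; lra.
    have F0' : 0 <= F i * / tau.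
      by apply: Rmult_le_pos => //; apply: Rlt_le; apply: Rinv_0_lt_compat.
    rewrite pw_mul //; last by lra.
    have h := pw_le_tangent t01 F0'.
    have -> : pw tau t * ((1 - t) * w i + t * / tau * (w i * (tau * (F i * / tau)))) =
       (w i * pw tau t) * (1 - t + t * (F i * / tau)) by field; lra.
    rewrite -Rmult_assoc; apply: Rmult_le_compat_l => //.
    by apply: Rmult_le_pos => //; lra.
  apply: Rle_trans (rsum_le pt) _.
  rewrite rsum_mull rsum_add !rsum_mull wH Rmult_comm.
  apply: Rmult_le_compat_r; first by lra.
  have -> : H = (1 - t) * H + t * / tau * (H * tau) by field; lra.
  have -> : (1 - t) * ((1 - t) * H + t * / tau * (H * tau)) = (1 - t) * H by field; lra.
  apply: Rplus_le_compat_l; apply: Rmult_le_compat_l => //.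
  by apply: Rmult_le_pos; [lra | apply: Rlt_le; apply: Rinv_0_lt_compat].
rewrite pw0 Rmult_0_r; rewrite Rmult_0_r in wF.
rewrite (@eq_rsum _ _ (fun=> 0)) => [|i]; first by rewrite rsum_const; lra.
have : w i * F i = 0.
  by apply: (@rsum_eq0 _ (fun i => w i * F i)) => // j; apply: Rmult_le_pos.
by move=> /Rmult_integral[]->; rewrite ?pw0; ring.
Qed.

End Powers.

(** * Gallager's bound for an arbitrary finite channel and input law *)

Section RandomCoding.
Variables (Msg Inp Out : finType) (P : Msg -> R) (Q : Inp -> R) (W : Inp -> Out -> R).
Hypotheses (P0 : forall m, 0 <= P m) (W0 : forall a y, 0 <= W a y).
Hypotheses (Q0 : forall a, 0 <= Q a) (Q1 : rsum Q = 1).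

Definition code_weight (f : {ffun Msg -> Inp}) : R := \big[Rmult/R1]_(m : Msg) Q (f m).

Lemma code_weight_ge0 f : 0 <= code_weight f.
Proof.
rewrite /code_weight; apply: (big_ind (fun x => 0 <= x)) => [|x y|m _]; first by lra.
  exact: Rmult_le_pos.
exact: Q0.
Qed.

(** Independence of the codewords, in product form. The expectations needed below follow by taking
    [phi] equal to 1 at all but one or two messages. *)
Lemma code_weight_prod (phi : Msg -> Inp -> R) :
  rsum (fun f : {ffun Msg -> Inp} =>
          code_weight f * \big[Rmult/R1]_(m : Msg) phi m (f m)) =
  \big[Rmult/R1]_(m : Msg) rsum (fun a => Q a * phi m a).
Proof.
rewrite /rsum bigA_distr_bigA; apply: eq_bigr => f _.
by rewrite /code_weight -big_split.
Qed.

Lemma code_weight_sum : rsum code_weight = 1.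
Proof.
rewrite (@eq_rsum _ _ (fun f => code_weight f * \big[Rmult/R1]_(m : Msg) 1)).
  rewrite (code_weight_prod (fun _ _ => 1)) big1 // => m _.
  by rewrite -[RHS]Q1; apply: eq_rsum => a; ring.
by move=> f; rewrite big1 //; ring.
Qed.

Lemma code_weight_pair (m m' : Msg) (h g : Inp -> R) : m' != m ->
  rsum (fun f : {ffun Msg -> Inp} => code_weight f * (h (f m) * g (f m'))) =
  rsum (fun a => Q a * h a) * rsum (fun a => Q a * g a).
Proof.
move=> mm'.
pose phi i a := if i == m then h a else if i == m' then g a else 1.
transitivity (rsum (fun f : {ffun Msg -> Inp} =>
          code_weight f * \big[Rmult/R1]_i phi i (f i))).
  apply: eq_rsum => f; congr (_ * _).
  rewrite (bigD1 m) // (bigD1 m') //= /phi eqxx (negPf mm') eqxx big1; first by ring.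
  by move=> i /andP[/negPf-> /negPf->].
rewrite code_weight_prod (bigD1 m) // (bigD1 m') //= /phi eqxx (negPf mm') eqxx big1.
  by ring.
move=> i /andP[/negPf-> /negPf->]; rewrite -[RHS]Q1.
by apply: eq_rsum => a; ring.
Qed.

Lemma code_weight_single (m : Msg) (h : Inp -> R) :
  rsum (fun f : {ffun Msg -> Inp} => code_weight f * h (f m)) =
  rsum (fun a => Q a * h a).
Proof.
pose phi i a := if i == m then h a else 1.
transitivity (rsum (fun f : {ffun Msg -> Inp} =>
          code_weight f * \big[Rmult/R1]_i phi i (f i))).
  apply: eq_rsum => f; congr (_ * _).
  rewrite (bigD1 m) //= /phi eqxx big1; first by ring.
  by move=> i /negPf->.
rewrite code_weight_prod (bigD1 m) //= /phi eqxx big1; first by ring.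
by move=> i /negPf->; rewrite -[RHS]Q1; apply: eq_rsum => a; ring.
Qed.

Variable s : R.
Hypothesis s_bound : 0 < s <= 1 / 2.

Lemma rho_bound : 0 < s / (1 - s) <= 1.
Proof.
have i0 : 0 < / (1 - s) by apply: Rinv_0_lt_compat; lra.
split; first by apply: Rmult_lt_0_compat; lra.
apply: (Rmult_le_reg_r (1 - s)); first by lra.
by rewrite /Rdiv Rmult_assoc Rinv_l; lra.
Qed.

Definition rivals (y : Out) (m : Msg) (f : Msg -> Inp) : R :=
  rsum (fun m' => if m' == m then 0 else pw (P m') (1 - s) * pw (W (f m') y) (1 - s)).

Lemma rivals_ge0 y m f : 0 <= rivals y m f.
Proof.
apply: rsum_ge0 => m'; case: eqP => _; first by lra.
by apply: Rmult_le_pos; apply: pw_ge0.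
Qed.

(** When the decoder errs, [d] is itself a rival scoring at least al = P(m) W(y|f(m)), so [rivals]
    is at least al^(1-s) and its power s/(1-s) is at least al^s. The product of the two factors is
    at least al. *)
Lemma map_error_le (f : Msg -> Inp) (y : Out) (d m : Msg) :
  (forall m', P m' * W (f m') y <= P d * W (f d) y) ->
  P m * (W (f m) y * (if d == m then 0 else 1)) <=
  pw (P m) (1 - s) * pw (W (f m) y) (1 - s) * pw (rivals y m f) (s / (1 - s)).
Proof.
move=> dmax; case: eqP => [_|/eqP dm].
  have h := pw_ge0 (rivals y m f) (s / (1 - s)).
  have h1 := pw_ge0 (P m) (1 - s); have h2 := pw_ge0 (W (f m) y) (1 - s).
  by rewrite !Rmult_0_r; apply: Rmult_le_pos => //; apply: Rmult_le_pos.
have q0 m' : 0 <= P m' * W (f m') y by apply: Rmult_le_pos.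
rewrite -pw_mul // Rmult_1_r; set al := P m * _.
have al0 : 0 <= al by apply: q0.
have le1 : pw al (1 - s) <= rivals y m f.
  apply: (@Rle_trans _ (pw (P d * W (f d) y) (1 - s))).
    by apply: pw_le; [lra | split=> //; apply: dmax].
  pose F m' := if m' == m then 0 else pw (P m') (1 - s) * pw (W (f m') y) (1 - s).
  have -> : pw (P d * W (f d) y) (1 - s) = F d by rewrite /F (negPf dm) pw_mul.
  apply: (@rsum_ge _ F d) => j; rewrite /F; case: eqP => _; first by lra.
  by apply: Rmult_le_pos; apply: pw_ge0.
have le2 : pw al s <= pw (rivals y m f) (s / (1 - s)).
  have -> : pw al s = pw (pw al (1 - s)) (s / (1 - s)).
    by rewrite pw_pw //; congr pw; field; lra.
  apply: pw_le; first by have := rho_bound; lra.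
  by split=> //; apply: pw_ge0.
rewrite -{1}(pw1 al0) (_ : 1 = (1 - s) + s); last by ring.
rewrite pw_add //.
have -> : 1 - s + s - s = 1 - s by ring.
by apply: Rmult_le_compat_l => //; apply: pw_ge0.
Qed.

Definition source_metric : R := rsum (fun m => pw (P m) (1 - s)).
Definition channel_metric (y : Out) : R := rsum (fun a => Q a * pw (W a y) (1 - s)).

Lemma channel_metric_ge0 y : 0 <= channel_metric y.
Proof. by apply: rsum_ge0 => a; apply: Rmult_le_pos => //; apply: pw_ge0. Qed.

(** Concavity is applied with weights that include the metric of the codeword of [m]. The remaining
    average involves two distinct messages at a time, so pairwise independence evaluates it. *)
Lemma average_rivals_le (y : Out) (m : Msg) :
  rsum (fun f : {ffun Msg -> Inp} => code_weight f *
    (pw (P m) (1 - s) * pw (W (f m) y) (1 - s) * pw (rivals y m f) (s / (1 - s)))) <=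
  pw (P m) (1 - s) * channel_metric y *
    pw (source_metric * channel_metric y) (s / (1 - s)).
Proof.
pose w (f : {ffun Msg -> Inp}) :=
  code_weight f * (pw (P m) (1 - s) * pw (W (f m) y) (1 - s)).
rewrite (@eq_rsum _ _ (fun f => w f * pw (rivals y m f) (s / (1 - s)))); last first.
  by move=> f; rewrite /w; ring.
have cm0 := channel_metric_ge0 y.
apply: rsum_pw_concave => [|f|f|||].
- exact: rho_bound.
- apply: Rmult_le_pos; first exact: code_weight_ge0.
  by apply: Rmult_le_pos; apply: pw_ge0.
- exact: rivals_ge0.
- by apply: Rmult_le_pos => //; apply: rsum_ge0 => ?; apply: pw_ge0.
- rewrite /w (code_weight_single m (fun a => pw (P m) (1 - s) * pw (W a y) (1 - s))).
  by rewrite /channel_metric -rsum_mull; apply: eq_rsum => a; ring.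
have cm1 : 0 <= pw (P m) (1 - s) * channel_metric y.
  by apply: Rmult_le_pos => //; apply: pw_ge0.
have -> : rsum (fun f => w f * rivals y m f) =
    rsum (fun m' => if m' == m then 0 else
      pw (P m) (1 - s) * channel_metric y * (pw (P m') (1 - s) * channel_metric y)).
  transitivity (rsum (fun f => rsum (fun m' => w f *
    (if m' == m then 0 else pw (P m') (1 - s) * pw (W (f m') y) (1 - s))))).
    by apply: eq_rsum => f; rewrite rsum_mull.
  rewrite rsum_exchange; apply: eq_rsum => m'; case: eqP => [_|/eqP mm'].
    by rewrite (@eq_rsum _ _ (fun=> 0)) ?rsum_const => [|f]; ring.
  pose c := pw (P m) (1 - s) * pw (P m') (1 - s).
  pose g a := pw (W a y) (1 - s).
  transitivity (c * rsum (fun f : {ffun Msg -> Inp} => code_weight f * (g (f m) * g (f m')))).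
    by rewrite -rsum_mull; apply: eq_rsum => f; rewrite /w /c /g; ring.
  by rewrite code_weight_pair // /c /channel_metric /g; ring.
(* Restoring the excluded term m' = m only increases the sum and completes it to the full source
   metric. *)
rewrite /source_metric -rsum_mulr -rsum_mull.
apply: rsum_le => m'; case: eqP => _; last by lra.
apply: Rmult_le_pos => //; apply: Rmult_le_pos => //; exact: pw_ge0.
Qed.

(* Gallager's bound, with [rho = s / (1 - s)]; the codewords are drawn
   independently from [Q] and the decoder is MAP. *)
Lemma random_coding_bound (m0 : Msg) :
  exists (e : Msg -> Inp) (d : Out -> Msg),
    rsum (fun m => P m * rsum (fun y => W (e m) y * (if d y == m then 0 else 1))) <=
    rsum (fun y => pw (source_metric * channel_metric y) (/ (1 - s))).
Proof.
have [D DP] : exists D : {ffun Msg -> Inp} * Out -> Msg,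
    forall (z : {ffun Msg -> Inp} * Out) m', P m' * W (z.1 m') z.2 <= P (D z) * W (z.1 (D z)) z.2.
  apply: (choice (fun (z : {ffun Msg -> Inp} * Out) d => forall m', P m' * W (z.1 m') z.2 <= P d * W (z.1 d) z.2)).
  by move=> z; exact: (finite_argmax m0 (fun m' => P m' * W (z.1 m') z.2)).
pose err (f : {ffun Msg -> Inp}) :=
  rsum (fun m => P m * rsum (fun y => W (f m) y * (if D (f, y) == m then 0 else 1))).
set B := rsum _.
suff [f fB] : exists f, err f <= B by exists f, (fun y => D (f, y)).
have avg : rsum (fun f => code_weight f * err f) <= B.
  pose F (f : {ffun Msg -> Inp}) y m := code_weight f *
    (pw (P m) (1 - s) * pw (W (f m) y) (1 - s) * pw (rivals y m f) (s / (1 - s))).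
  apply: (@Rle_trans _ (rsum (fun f => rsum (fun y => rsum (fun m => F f y m))))).
    apply: rsum_le => f; rewrite /err.
    rewrite [X in _ * X <= _](_ : _ = rsum (fun m => rsum (fun y =>
        P m * (W (f m) y * (if D (f, y) == m then 0 else 1))))); last first.
      by apply: eq_rsum => m; rewrite rsum_mull.
    rewrite rsum_exchange -rsum_mull; apply: rsum_le => y.
    rewrite -rsum_mull; apply: rsum_le => m.
    apply: Rmult_le_compat_l; first exact: code_weight_ge0.
    by apply: map_error_le => m'; apply: (DP (f, y)).
  rewrite rsum_exchange; apply: rsum_le => y; rewrite rsum_exchange.
  apply: Rle_trans (rsum_le (average_rivals_le y)) _; apply: Req_le.
  (* Summing over messages yields q * q^(s/(1-s)), and 1 + s/(1-s) = 1/(1-s). *)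
  rewrite !rsum_mulr -/source_metric; set q := source_metric * _.
  have q0 : 0 <= q.
    apply: Rmult_le_pos; last exact: channel_metric_ge0.
    by apply: rsum_ge0 => ?; apply: pw_ge0.
  rewrite -{1}(pw1 q0) -pw_add //; congr pw; field; lra.
(* If every codebook exceeded the average bound, all codebook weights would vanish, although they
   sum to 1. *)
apply: NNPP => no.
have gt f : 0 < err f - B.
  by case: (Rle_lt_dec (err f) B) => h; [case: no; exists f | lra].
have w0 f : code_weight f = 0.
  have : code_weight f * (err f - B) = 0.
    apply: (@rsum_eq0 _ (fun f => code_weight f * (err f - B))) => [g|].
      by apply: Rmult_le_pos; [exact: code_weight_ge0 | apply: Rlt_le].
    rewrite (@eq_rsum _ _ (fun f => code_weight f * err f + code_weight f * - B)).
      by rewrite rsum_add rsum_mulr code_weight_sum; lra.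
    by move=> g; ring.
  by move=> /Rmult_integral[]//; have := gt f; lra.
by have := code_weight_sum; rewrite (@eq_rsum _ _ (fun=> 0)) // rsum_const; lra.
Qed.

End RandomCoding.

(** * Growth of Markov path sums *)

Section MarkovGrowth.

Lemma rsum_tuple0 (T : finType) (F : 0.-tuple T -> R) : rsum F = F [tuple].
Proof.
rewrite (@eq_rsum _ _ (fun=> F [tuple])) => [|t]; last by rewrite tuple0.
by rewrite rsum_const card_tuple expn0 /=; ring.
Qed.

Lemma rsum_tupleS (T : finType) n (F : n.+1.-tuple T -> R) :
  rsum F = rsum (fun a => rsum (fun t : n.-tuple T => F [tuple of a :: t])).
Proof.
rewrite /rsum pair_big /= (reindex (fun p : T * n.-tuple T => [tuple of p.1 :: p.2])) //=.
exists (fun t : n.+1.-tuple T => (thead t, [tuple of behead t])) => [[a t] _|t _].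
  by congr pair; apply: val_inj.
by rewrite -tuple_eta.
Qed.

Lemma chain_ge0 (T : Type) (A : T -> T -> R) a s :
  (forall i j, 0 <= A i j) -> 0 <= chain A a s.
Proof.
by move=> A0; elim: s a => [|b s IH] a /=; [lra | apply: Rmult_le_pos].
Qed.

Lemma mlaw_ge0 (T : Type) (P : T -> R) (A : T -> T -> R) s :
  (forall i, 0 <= P i) -> (forall i j, 0 <= A i j) -> 0 <= mlaw P A s.
Proof.
move=> P0 A0; case: s => [|a s] /=; first by lra.
by apply: Rmult_le_pos => //; apply: chain_ge0.
Qed.

Lemma pw_chain (T : Type) (A : T -> T -> R) t a s : (forall i j, 0 <= A i j) ->
  pw (chain A a s) t = chain (fun i j => pw (A i j) t) a s.
Proof.
move=> A0; elim: s a => [|b s IH] a /=; first exact: one_pw.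
by rewrite pw_mul ?IH //; apply: chain_ge0.
Qed.

Lemma pw_mlaw (T : Type) (P : T -> R) (A : T -> T -> R) t s :
  (forall i, 0 <= P i) -> (forall i j, 0 <= A i j) ->
  pw (mlaw P A s) t = mlaw (fun i => pw (P i) t) (fun i j => pw (A i j) t) s.
Proof.
move=> P0 A0; case: s => [|a s] /=; first exact: one_pw.
by rewrite pw_mul ?pw_chain //; apply: chain_ge0.
Qed.

Lemma mlaw_map (S T : Type) (f : S -> T) (P : T -> R) (A : T -> T -> R) s :
  mlaw P A (map f s) = mlaw (fun i => P (f i)) (fun i j => A (f i) (f j)) s.
Proof.
have chain_map a t : chain A (f a) (map f t) = chain (fun i j => A (f i) (f j)) a t.
  by elim: t a => //= b t IH a; rewrite IH.
by case: s => //= a s; rewrite chain_map.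
Qed.

(** With c a lower bound of [u], the constant 1 is at most u/c, which the left action of A
    multiplies by exactly [ka] at every letter. *)
Lemma mlaw_growth (T : finType) (P : T -> R) (A : T -> T -> R) (u : T -> R) (ka : R) :
  (forall i, 0 <= P i) -> (forall i j, 0 <= A i j) -> (forall i, 0 < u i) -> 0 < ka ->
  (forall j, rsum (fun i => u i * A i j) = ka * u j) ->
  exists2 C, 0 < C & forall n, rsum (fun t : n.-tuple T => mlaw P A t) <= C * ka ^ n.
Proof.
move=> P0 A0 u0 k0 uA; have [c c0 cu] := finite_pos_lower u0.
have growth n a : rsum (fun t : n.-tuple T => chain A a t) <= ka ^ n * (u a / c).
  elim: n a => [|n IH] a.
    rewrite rsum_tuple0 /= Rmult_1_l; apply: (Rmult_le_reg_r c) => //.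
    by rewrite /Rdiv Rmult_assoc Rinv_l ?Rmult_1_r ?Rmult_1_l; [apply: cu | lra].
  rewrite rsum_tupleS.
  have -> : ka ^ n.+1 * (u a / c) = rsum (fun b => A b a * (ka ^ n * (u b / c))).
    transitivity (ka ^ n / c * rsum (fun i => u i * A i a)).
      by rewrite uA /=; field; lra.
    by rewrite -rsum_mull; apply: eq_rsum => b; field; lra.
  by apply: rsum_le => b /=; rewrite rsum_mull; apply: Rmult_le_compat_l.
pose S := rsum (fun a => P a * (u a / c)).
have S0 : 0 <= S.
  apply: rsum_ge0 => a; apply: Rmult_le_pos => //; apply: Rlt_le.
  exact: Rdiv_lt_0_compat.
have Sk : 0 <= S / ka.
  by apply: Rmult_le_pos => //; apply: Rlt_le; apply: Rinv_0_lt_compat.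
(* The summand 1 serves the empty word; the division by [ka] compensates for the first letter, which
   is drawn from P and involves no transition. *)
exists (1 + S / ka) => [|[|n]]; first by lra.
  by rewrite rsum_tuple0 /=; lra.
rewrite rsum_tupleS; apply: (@Rle_trans _ (S * ka ^ n)).
  rewrite -rsum_mulr; apply: rsum_le => a /=; rewrite rsum_mull Rmult_assoc.
  by apply: Rmult_le_compat_l => //; rewrite Rmult_comm; apply: growth.
have kn : 0 < ka ^ n.+1 by apply: pow_lt.
have -> : S * ka ^ n = S / ka * ka ^ n.+1 by rewrite /=; field; lra.
by apply: Rmult_le_compat_r; lra.
Qed.

End MarkovGrowth.

(** * Summing the noise law over codewords *)

Section ConditionalSum.
Variables (X : finZmodType) (Z : finType) (P : X * Z -> R) (A : X * Z -> X * Z -> R).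
Variables (u : X * Z -> R) (K : Z -> Z -> R).
Hypotheses (P0 : forall p, 0 <= P p) (A0 : forall p q, 0 <= A p q).
Hypothesis (u0 : forall p, 0 < u p).
Hypothesis uK : forall z p, rsum (fun x => A (x, z) p * u (x, z)) = K z p.2 * u p.

Lemma rsum_subl (F : X -> R) b : rsum (fun a => F (b - a)%R) = rsum F.
Proof.
by rewrite /rsum [RHS](reindex_inj (inv_inj (GRing.subKr b))).
Qed.

Lemma K_ge0 z z' : 0 <= K z z'.
Proof.
apply: (Rmult_le_reg_r (u (0%R, z'))) => //.
rewrite Rmult_0_l -(uK z (0%R, z')); apply: rsum_ge0 => x.
by apply: Rmult_le_pos => //; apply: Rlt_le.
Qed.

(** For a fixed output letter the noise x - a runs over the whole group as a does, so [uK] replaces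
    each factor A by K and passes [u] to the preceding state. The resulting bound sees only the
    z-part of the output. *)
Lemma mlaw_noise_le :
  exists2 C, 0 < C & forall n (y : n.-tuple (X * Z)),
    rsum (fun a : n.-tuple X => mlaw P A (noise_of y a)) <=
    C * mlaw (fun z => rsum (fun x => P (x, z) * u (x, z))) K (map snd y).
Proof.
have [c c0 cu] := finite_pos_lower u0.
have step n p (y : n.-tuple (X * Z)) :
    rsum (fun a : n.-tuple X => chain A p (noise_of y a)) <=
    chain K p.2 (map snd y) * (u p / c).
  elim: n p y => [|n IH] p y.
    rewrite rsum_tuple0 (tuple0 y) /= Rmult_1_l; apply: (Rmult_le_reg_r c) => //.
    by rewrite /Rdiv Rmult_assoc Rinv_l ?Rmult_1_r ?Rmult_1_l; [apply: cu | lra].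
  case/tupleP: y => q y; rewrite rsum_tupleS /=.
  apply: (@Rle_trans _ (rsum (fun a => A ((q.1 - a)%R, q.2) p *
     (chain K q.2 (map snd y) * (u ((q.1 - a)%R, q.2) / c))))).
    by apply: rsum_le => a; rewrite rsum_mull; apply: Rmult_le_compat_l => //; apply: IH.
  rewrite (rsum_subl (fun x => A (x, q.2) p *
     (chain K q.2 (map snd y) * (u (x, q.2) / c))) q.1).
  apply: Req_le.
  transitivity (chain K q.2 (map snd y) / c * (K q.2 p.2 * u p)).
    by rewrite -uK -rsum_mull; apply: eq_rsum => x /=; field; lra.
  by field; lra.
have ic : 0 < / c by apply: Rinv_0_lt_compat.
exists (1 + / c) => [|[|n] y]; first by lra.
  by rewrite rsum_tuple0 (tuple0 y) /=; lra.
case/tupleP: y => q y; rewrite rsum_tupleS /=.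
set S := rsum (fun x => P (x, q.2) * _).
have S0 : 0 <= S * chain K q.2 (map snd y).
  apply: Rmult_le_pos; last exact: (chain_ge0 _ _ K_ge0).
  by apply: rsum_ge0 => x; apply: Rmult_le_pos => //; apply: Rlt_le.
apply: (@Rle_trans _ (/ c * (S * chain K q.2 (map snd y)))); last by nra.
apply: (@Rle_trans _ (rsum (fun a => P ((q.1 - a)%R, q.2) *
     (chain K q.2 (map snd y) * (u ((q.1 - a)%R, q.2) / c))))).
  by apply: rsum_le => a; rewrite rsum_mull; apply: Rmult_le_compat_l => //; apply: step.
rewrite (rsum_subl (fun x => P (x, q.2) *
     (chain K q.2 (map snd y) * (u (x, q.2) / c))) q.1).
apply: Req_le; transitivity (chain K q.2 (map snd y) / c * S).
  by rewrite -rsum_mull; apply: eq_rsum => x /=; field; lra.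
by field; lra.
Qed.

End ConditionalSum.

(** * The comparison with the upper conditional entropy *)

Section UpperEntropy.
Variables (X : finZmodType) (Z : finType) (Wc : X * Z -> X * Z -> R) (s : R).
Hypotheses (Wc_trans : is_trans Wc) (irrWc : irreducible Wc).
Hypothesis s_bound : 0 < s < 1.
Variable q0 : X * Z.

Local Notation A := (fun p q => pw (Wc p q) (1 - s)).

Let A0 p q : 0 <= A p q. Proof. exact: pw_ge0. Qed.

Lemma irreducible_pw (T : finType) (W : T -> T -> R) t :
  (forall i j, 0 <= W i j) -> irreducible W -> irreducible (fun i j => pw (W i j) t).
Proof.
move=> W0; apply: (@irreducible_image _ _ id id) => // [i j|i j].
  exact: pw_ge0.
exact: pw_gt0.
Qed.

(* Both cases of Assumption 2 are instances of this: [u = 1] in the first one,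
   the left Perron-Frobenius eigenvector in the second one. *)
Lemma assumption2_conditional : assumption2 Wc ->
  exists (u : X * Z -> R) (K : Z -> Z -> R), (forall p, 0 < u p) /\
    forall z p, rsum (fun x => A (x, z) p * u (x, z)) = K z p.2 * u p.
Proof.
case=> [indep|Z1].
  exists (fun=> 1), (fun z z' => rsum (fun x => A (x, z) (0%R, z'))).
  split=> [p|z [x' z']]; first by lra.
  rewrite Rmult_1_r (@eq_rsum _ _ (fun x => A (x, z) (x', z'))) => [|x]; last by ring.
  by apply: indep; lra.
have irrA : irreducible A by apply: irreducible_pw => //; case: Wc_trans.
have [_ [u [u0 uA]]] := PFeig_left_eigenvector q0 A0 irrA.
exists u, (fun _ _ => PFeig A); split=> // z p; rewrite -uA.
have Zz z' : z' = z.
  have /fintype_le1P zz : (#|Z| <= 1)%N by rewrite Z1.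
  exact: (zz z z').
transitivity (rsum (fun x => rsum (fun z' => u (x, z') * A (x, z') p))).
  apply: eq_rsum => x; rewrite (@eq_rsum _ _ (fun=> u (x, z) * A (x, z) p)).
    by rewrite rsum_const Z1 /=; ring.
  by move=> z'; rewrite (Zz z').
by rewrite /rsum pair_big /=; apply: eq_bigr => -[].
Qed.

(** The content is that [Rsup] is a true supremum here: all entries of the tilted matrix are at most
    1, so its eigenvalue is at most the number of states, whatever V is. *)
Lemma Hup_ge V : is_trans V -> (forall z z', 0 < WcZ Wc z z' -> 0 < V z z') ->
  HcV Wc s V <= Hup Wc s.
Proof.
move=> Vt Vpos; have [[W0 W1] [V0 V1]] := (Wc_trans, Vt).
have le1 (T : finType) (W : T -> T -> R) i j : is_trans W -> W i j <= 1.
  by move=> [w0 w1]; rewrite -(w1 j); apply: (rsum_ge i (fun i => w0 i j)).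
have pw_le1 a t : 0 <= t -> 0 <= a <= 1 -> pw a t <= 1.
  by move=> t0 a01; rewrite -(one_pw t); apply: pw_le.
pose b := INR #|{: X * Z}|.
have b1 : 1 <= b.
  by rewrite -[1]/(INR 1); apply: le_INR; apply/leP/card_gt0P; exists q0.
have is0 : 0 < / s by apply: Rinv_0_lt_compat; lra.
have bound h : (exists V : Z -> Z -> R, is_trans V /\
    (forall z z', 0 < WcZ Wc z z' -> 0 < V z z') /\ h = HcV Wc s V) -> h <= / s * ln b.
  move=> [U [Ut [_ ->]]]; apply: Rmult_le_compat_l; first by lra.
  set D := fun p q => _.
  have Db : PFeig D <= b.
    apply: PFeig_le => [|q]; first by lra.
    apply: (@Rle_trans _ (rsum (fun _ : X * Z => 1))); last by rewrite rsum_const -/b; lra.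
    apply: rsum_le => p; rewrite /D /=.
    have := pw_ge0 (Wc p q) (1 - s); have := pw_ge0 (U p.2 q.2) s.
    have : pw (Wc p q) (1 - s) <= 1 by apply: pw_le1; [lra | split=> //; apply: le1].
    have : pw (U p.2 q.2) s <= 1.
      by apply: pw_le1; [lra | split; [case: Ut | apply: le1]].
    by move: (pw _ _) (pw (Wc p q) _) => x y; nra.
  have lnb : 0 <= ln b by rewrite -ln_1; apply: ln_le; lra.
  (* [ln] is 0 on nonpositive arguments, which [lnb] absorbs. *)
  case: (Rle_lt_dec (PFeig D) 0) => h0; last exact: ln_le.
  by rewrite ln_nonpos.
rewrite /Hup; set S := fun h => _.
have [l lubl] : exists l, is_lub S l.
  have [||l lubl] := completeness S.
  - by exists (/ s * ln b) => h; apply: bound.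
  - by exists (HcV Wc s V), V.
  by exists l.
by rewrite (Rsup_eq lubl); apply: (proj1 lubl); exists V.
Qed.

(* [V] is the optimiser of Hoelder's inequality relating
   [lambda (K V^s)] and [lambda (K^(1/(1-s)))]. *)
Lemma conditional_eigenvalue_le_Hup (u : X * Z -> R) (K : Z -> Z -> R) :
  (forall p, 0 < u p) ->
  (forall z p, rsum (fun x => A (x, z) p * u (x, z)) = K z p.2 * u p) ->
  exists ka (g : Z -> R), 0 < ka /\ (forall z, 0 < g z) /\
    (forall z', rsum (fun z => g z * pw (K z z') (/ (1 - s))) = ka * g z') /\
    (1 - s) * ln ka <= s * Hup Wc s.
Proof.
move=> u0 uK; have [W0 W1] := Wc_trans.
have K0 := K_ge0 A0 u0 uK.
have WK p q : 0 < Wc p q -> 0 < K p.2 q.2.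
  case: p => x z Wpq; apply: (Rmult_lt_reg_r (u q)) => //=.
  rewrite Rmult_0_l -uK; apply: (@rsum_gt0 _ _ x) => [x'|].
    by apply: Rmult_le_pos => //; apply: Rlt_le.
  by apply: Rmult_lt_0_compat => //; apply: pw_gt0.
pose L z z' := pw (K z z') (/ (1 - s)).
have L0 z z' : 0 <= L z z' by apply: pw_ge0.
have irrL : irreducible L.
  apply: (@irreducible_image _ _ snd (fun z => (q0.1, z)) Wc) => // p q Wpq.
  by apply: pw_gt0; apply: WK.
have [ka0 [g [g0 gL]]] := PFeig_left_eigenvector q0.2 L0 irrL.
set ka := PFeig L in ka0 gL.
exists ka, g; do 3![split=> //].
pose V z z' := L z z' * (g z * / (ka * g z')).
have kg z' : 0 < ka * g z' by apply: Rmult_lt_0_compat.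
have r0 z z' : 0 < g z * / (ka * g z').
  by apply: Rmult_lt_0_compat => //; apply: Rinv_0_lt_compat.
have V0 z z' : 0 <= V z z' by apply: Rmult_le_pos => //; apply: Rlt_le.
have Vt : is_trans V.
  split=> // z'; transitivity (/ (ka * g z') * rsum (fun z => g z * L z z')).
    by rewrite -rsum_mull; apply: eq_rsum => z; rewrite /V; ring.
  by rewrite gL; apply: Rinv_l; have := kg z'; lra.
have Vpos p q : 0 < Wc p q -> 0 < V p.2 q.2.
  by move=> Wpq; apply: Rmult_lt_0_compat => //; apply: pw_gt0; apply: WK.
have Vadm z z' : 0 < WcZ Wc z z' -> 0 < V z z'.
  by move=> /rsum_gt0_ex[]// x /Vpos.
apply: (@Rle_trans _ (s * HcV Wc s V)); last first.
  by apply: Rmult_le_compat_l; [lra | apply: Hup_ge].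
apply: Req_le; rewrite /HcV; set D := fun p q => _.
have D0 p q : 0 <= D p q by apply: Rmult_le_pos; apply: pw_ge0.
have irrD : irreducible D.
  apply: (@irreducible_image _ _ id id Wc) => // p q Wpq.
  by apply: Rmult_lt_0_compat; apply: pw_gt0 => //; apply: Vpos.
(* This is the positive left eigenvector of the tilted matrix [D], with eigenvalue ka^(1-s): summing
   over x turns A into K through [uK], and the sum over z then reduces to [gL]. *)
have w0 p : 0 < u p * pw (g p.2) (1 - s).
  by apply: Rmult_lt_0_compat => //; apply: pw_gt0.
suff Deig q : rsum (fun p => u p * pw (g p.2) (1 - s) * D p q) =
    pw ka (1 - s) * (u q * pw (g q.2) (1 - s)).
  by rewrite (PFeig_left q0 D0 irrD w0 Deig) ln_pw //; field; lra.
transitivity (rsum (fun z => pw (g z) (1 - s) * pw (V z q.2) s * (K z q.2 * u q))).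
  rewrite (@eq_rsum _ _ (fun p => pw (g p.2) (1 - s) * pw (V p.2 q.2) s *
      (A (p.1, p.2) q * u (p.1, p.2)))) => [|[x z]]; last by rewrite /D /A /=; ring.
  transitivity (rsum (fun x => rsum (fun z => pw (g z) (1 - s) * pw (V z q.2) s *
      (A (x, z) q * u (x, z))))).
    by rewrite /rsum pair_big.
  by rewrite rsum_exchange; apply: eq_rsum => z; rewrite -uK -rsum_mull.
(* The exponents recombine: g^(1-s) g^s = g, and K K^(s/(1-s)) = K^(1/(1-s)), leaving only the
   normalisation of V raised to the power s. *)
have term z : pw (g z) (1 - s) * pw (V z q.2) s * (K z q.2 * u q) =
    u q * / pw (ka * g q.2) s * (g z * L z q.2).
  have gz : pw (g z) (1 - s) * pw (g z) s = g z.
    rewrite -pw_add; last by apply: Rlt_le.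
    by rewrite -[RHS]pw1; [congr pw; ring | apply: Rlt_le].
  have Lz : pw (L z q.2) s * K z q.2 = L z q.2.
    rewrite /L pw_pw // -{2}(pw1 (K0 z q.2)) -pw_add //; congr pw; field; lra.
  rewrite -[in RHS]gz -[in RHS]Lz /V pw_mul //; last by apply: Rlt_le.
  rewrite pw_mul; [|by apply: Rlt_le|by apply: Rlt_le; apply: Rinv_0_lt_compat].
  by rewrite pw_inv //; ring.
rewrite (eq_rsum term) rsum_mull gL.
have h : ka * g q.2 = pw (ka * g q.2) s * pw (ka * g q.2) (1 - s).
  rewrite -pw_add; last by apply: Rlt_le.
  by rewrite -[LHS]pw1; [congr pw; ring | apply: Rlt_le].
rewrite [X in _ * X = _]h pw_mul; [|by apply: Rlt_le..].
by rewrite (pw_mul (1 - s)); [|by apply: Rlt_le..]; field; split; apply: Rgt_not_eq; apply: pw_gt0.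
Qed.

End UpperEntropy.

(** * Error exponent *)

Section ErrorProbability.
Variables (M : finType) (X : finZmodType) (Z : finType).
Variables (PM1 : M -> R) (Ws : M -> M -> R).
Variables (PXZ1 : X * Z -> R) (Wc : X * Z -> X * Z -> R).
Hypotheses (PM1_dist : is_dist PM1) (Ws_trans : is_trans Ws).
Hypotheses (PXZ1_dist : is_dist PXZ1) (Wc_trans : is_trans Wc).

(** The given code makes the set of error probabilities nonempty and 0 bounds it below, so the
    default value in [Rsup] does not occur. *)
Lemma Pj_bounds k n (e : k.-tuple M -> n.-tuple X) (d : n.-tuple (X * Z) -> k.-tuple M) :
  0 <= Pj PM1 Ws PXZ1 Wc k n <= err_prob PM1 Ws PXZ1 Wc e d.
Proof.
have [[p0 _] [w0 _] [q0 _] [c0 _]] := And4 PM1_dist Ws_trans PXZ1_dist Wc_trans.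
have err0 e' d' : 0 <= @err_prob M X Z PM1 Ws PXZ1 Wc k n e' d'.
  apply: rsum_ge0 => m; apply: Rmult_le_pos; first exact: mlaw_ge0.
  apply: rsum_ge0 => y; apply: Rmult_le_pos; first exact: mlaw_ge0.
  by case: ifP => _; lra.
rewrite /Pj /Rinf; set S := fun x => _.
have S0 x : S x -> x <= 0 by move=> [e' [d' h]]; have := err0 e' d'; lra.
have Se : S (- err_prob PM1 Ws PXZ1 Wc e d) by exists e, d; ring.
have [||l lubl] := completeness S.
- by exists 0 => x; apply: S0.
- by exists (- err_prob PM1 Ws PXZ1 Wc e d).
rewrite (Rsup_eq lubl); have [ub lub] := lubl.
by have := ub _ Se; have := lub 0 S0; lra.
Qed.

Lemma INR_expn m n : INR (m ^ n)%N = INR m ^ n.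
Proof. by elim: n => [|n IH]; rewrite ?expn0 // expnS mult_INR IH. Qed.

Lemma ex_pos_dist (T : finType) (P : T -> R) : is_dist P -> exists i : T, 0 < P i.
Proof. by move=> [P0 P1]; apply: rsum_gt0_ex => //; lra. Qed.

Variable s : R.
Hypotheses (s_bound : 0 < s <= 1 / 2).
Hypotheses (irrWs : irreducible Ws) (irrWc : irreducible Wc) (Wc_ass : assumption2 Wc).

Lemma Pj_exponential_bound :
  exists C ka : R, 0 < C /\ 0 < ka /\ (1 - s) * ln ka <= s * Hup Wc s /\
    forall k n, Pj PM1 Ws PXZ1 Wc k n <=
      C * pw (PFeig (fun m m' => pw (Ws m m') (1 - s)) ^ k * / INR #|X| ^ n) (/ (1 - s))
        * (INR #|X| * ka) ^ n.
Proof.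
have [[p0 _] [w0 _] [q0 _] [c0 _]] := And4 PM1_dist Ws_trans PXZ1_dist Wc_trans.
have [m0 _] := ex_pos_dist PM1_dist; have [xz0 _] := ex_pos_dist PXZ1_dist.
have s01 : 0 < s < 1 by lra.
pose As m m' := pw (Ws m m') (1 - s).
set la := PFeig _; set N := INR #|X|; set t := / (1 - s).
have As0 i j : 0 <= As i j by apply: pw_ge0.
have [la0 [us [us0 usA]]] := PFeig_left_eigenvector m0 As0 (irreducible_pw (1 - s) w0 irrWs).
rewrite -/la in la0 usA.
have [Cs Cs0 Csb] := mlaw_growth (P := fun m => pw (PM1 m) (1 - s))
  (fun m => pw_ge0 _ _) As0 us0 la0 usA.
have [u [K [u0 uK]]] := assumption2_conditional Wc_trans irrWc s01 xz0 Wc_ass.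
have [ka [g [ka0 [g0 [gL kaH]]]]] :=
  conditional_eigenvalue_le_Hup Wc_trans irrWc s01 xz0 u0 uK.
have [Cn Cn0 Cnb] := mlaw_noise_le (P := fun p => pw (PXZ1 p) (1 - s))
  (fun p => pw_ge0 _ _) (fun p q => pw_ge0 _ _) u0 uK.
set h := fun z => rsum _ in Cnb.
have h0 z : 0 <= h z.
  by apply: rsum_ge0 => x; apply: Rmult_le_pos; [apply: pw_ge0 | apply: Rlt_le].
have K0 := K_ge0 (fun p q => pw_ge0 _ _) u0 uK.
have N0 : 0 < N by apply: lt_0_INR; apply/ltP/card_gt0P; exists xz0.1.
have Nka0 : 0 < N * ka by apply: Rmult_lt_0_compat.
(* The matrix on X * Z ignores the x-coordinate, so lifting [g] gives a left eigenvector whose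
   eigenvalue is [ka] times the number of values of x. *)
have [||||C2 C20 C2b] := @mlaw_growth _ (fun p : X * Z => pw (h p.2) t)
    (fun p q => pw (K p.2 q.2) t) (fun p => g p.2) (N * ka) _ _ _ Nka0.
- by move=> p; apply: pw_ge0.
- by move=> p q; apply: pw_ge0.
- by [].
- move=> q; transitivity (rsum (fun x : X => rsum (fun z => g z * pw (K z q.2) t))).
    by rewrite /rsum pair_big.
  by rewrite rsum_const gL -/N; ring.
exists (pw (Cs * Cn) t * C2), ka; split.
  by apply: Rmult_lt_0_compat => //; apply: pw_gt0; apply: Rmult_lt_0_compat.
split=> //; split=> // k n.
pose Q (a : n.-tuple X) := / N ^ n.
have Nn0 : 0 < N ^ n by apply: pow_lt.
have iNn0 : 0 < / N ^ n by apply: Rinv_0_lt_compat.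
have Q1 : rsum Q = 1 by rewrite rsum_const card_tuple INR_expn -/N; apply: Rinv_r; lra.
pose W (a : n.-tuple X) (y : n.-tuple (X * Z)) := mlaw PXZ1 Wc (noise_of y a).
have W0 a y : 0 <= W a y by apply: mlaw_ge0.
have mm0 : k.-tuple M := [tuple of nseq k m0].
have [e [d ed]] := @random_coding_bound _ _ _ (fun m : k.-tuple M => mlaw PM1 Ws m) Q
  W (fun m => mlaw_ge0 _ p0 w0) W0 (fun a => Rlt_le _ _ iNn0) Q1 s s_bound mm0.
have [_ Ple] := Pj_bounds e d; apply: Rle_trans Ple _; apply: Rle_trans ed _.
have t0 : 0 < t by apply: Rinv_0_lt_compat; lra.
have lak : 0 < la ^ k by apply: pow_lt.
set S := source_metric _ _.
have S0 : 0 <= S by apply: rsum_ge0 => m; apply: pw_ge0.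
have Sb : S <= Cs * la ^ k.
  by apply: Rle_trans (Csb k); apply: rsum_le => m; rewrite pw_mlaw //; exact: Rle_refl.
pose ml (y : n.-tuple (X * Z)) := mlaw h K (map snd y).
have ml0 y : 0 <= ml y by apply: mlaw_ge0.
have cmb y : channel_metric Q W s y <=
    / N ^ n * (Cn * ml y).
  rewrite /channel_metric rsum_mull; apply: Rmult_le_compat_l; first by lra.
  by apply: Rle_trans (Cnb n y); apply: rsum_le => a; rewrite pw_mlaw //; exact: Rle_refl.
pose c := Cs * Cn * (la ^ k * / N ^ n).
have c0' : 0 < c by do !apply: Rmult_lt_0_compat.
apply: (@Rle_trans _ (rsum (fun y => pw c t * pw (ml y) t))).
  apply: rsum_le => y; rewrite -pw_mul //; last by lra.
  apply: pw_le; first exact: Rlt_le t0.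
  have cm0 := channel_metric_ge0 W (fun a => Rlt_le _ _ iNn0) s y.
  split; first exact: Rmult_le_pos.
  have -> : c * ml y = Cs * la ^ k * (/ N ^ n * (Cn * ml y)) by rewrite /c; ring.
  by apply: Rmult_le_compat.
have -> : pw (Cs * Cn) t * C2 * pw (la ^ k * / N ^ n) t * (N * ka) ^ n =
    pw c t * (C2 * (N * ka) ^ n).
  rewrite /c (pw_mul t (a := Cs * Cn)); first by ring.
    by apply: Rlt_le; apply: Rmult_lt_0_compat.
  by apply: Rlt_le; apply: Rmult_lt_0_compat.
rewrite rsum_mull; apply: Rmult_le_compat_l; first exact: pw_ge0.
apply: Rle_trans (C2b n); apply: rsum_le => y; apply: Req_le.
by rewrite /ml pw_mlaw // mlaw_map.
Qed.

End ErrorProbability.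

Lemma floor_nat_bounds x : 0 <= x -> x - 1 <= INR (floor_nat x) <= x.
Proof.
move=> x0; have [h1 h2] := base_Int_part x; rewrite /floor_nat.
have i0 : (0 <= Int_part x)%Z.
  have : (-1 < Int_part x)%Z by apply: lt_IZR; lra.
  lia.
by rewrite INR_IZR_INZ Z2Nat.id //; lra.
Qed.

Theorem mainTheorem14
  (M : finType) (X : finZmodType) (Z : finType)
  (PM1 : M -> R) (Ws : M -> M -> R)
  (PXZ1 : X * Z -> R) (Wc : X * Z -> X * Z -> R) (r : R) :
  is_dist PM1 -> is_trans Ws -> irreducible Ws -> aperiodic Ws ->
  is_dist PXZ1 -> is_trans Wc -> irreducible Wc -> aperiodic Wc ->
  assumption2 Wc ->
  0 < r ->
  (exists hs hc : R,
     limit1_in (HWs Ws) (fun t => t <> 0 /\ t < 1) hs 0 /\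
     limit1_in (Hdown Wc) (fun t => t <> 0 /\ t < 1) hc 0 /\
     r * hs + hc < ln (INR #|X|)) ->
  (* liminf_n -1/n log P_j(floor(rn),n) >= sup_{s in (0,1/2]} (sR - U(s))/(1-s) *)
  forall s : R, 0 < s <= 1 / 2 ->
  forall eps : R, 0 < eps ->
  exists N : nat, forall n : nat, (N <= n)%N ->
    let P := Pj PM1 Ws PXZ1 Wc (floor_nat (r * INR n)) n in
    P = 0 \/
    (s * ln (INR #|X|) - Uup Ws Wc r s) / (1 - s) - eps <= - (/ INR n) * ln P.
Proof.
move=> dPM tWs irrWs _ dPXZ tWc irrWc _ ass2 r0 _ s s_bound eps eps0.
have [C [ka [C0 [ka0 [kaH Pb]]]]] :=
  Pj_exponential_bound dPM tWs dPXZ tWc s_bound irrWs irrWc ass2.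
have [m0 _] := ex_pos_dist dPM; have [xz0 _] := ex_pos_dist dPXZ.
set la := PFeig _ in Pb.
have la0 : 0 < la.
  have [w0 _] := tWs.
  by have [] := PFeig_left_eigenvector m0 (fun m m' => pw_ge0 (Ws m m') (1 - s))
    (irreducible_pw (1 - s) w0 irrWs).
pose t := / (1 - s).
have t0 : 0 < t by apply: Rinv_0_lt_compat; lra.
(* All errors that do not grow with n: the prefactor [C], and the loss of less than one source
   letter to the floor, with [Rabs] covering either sign of [ln la]. *)
pose D := ln C + t * Rabs (ln la).
have [N NP] := INR_archimed eps D eps0.
exists N.+1 => n Nn P; set k := floor_nat _ in P *.
have n0 : 0 < INR n by apply: lt_0_INR; apply/ltP; apply: leq_trans Nn.
have Deps : D <= INR n * eps.
  have : INR N <= INR n by apply: le_INR; apply/leP; apply: ltnW.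
  by nra.
have m_k : k.-tuple M := [tuple of nseq k m0].
have [P0 _] : 0 <= P <= _ := Pj_bounds dPM tWs dPXZ tWc
  (fun _ : k.-tuple M => [tuple of nseq n xz0.1]) (fun _ => m_k).
(* At P = 0 the true exponent is infinite whereas [ln 0] is 0, hence the separate disjunct. *)
case: P0 => [P0|P0]; last by left.
right.
set R0 := ln (INR #|X|).
have X0 : 0 < INR #|X| by apply: lt_0_INR; apply/ltP/card_gt0P; exists xz0.1.
have lak : 0 < la ^ k by apply: pow_lt.
have Xn : 0 < / INR #|X| ^ n by apply: Rinv_0_lt_compat; apply: pow_lt.
have Xka : 0 < INR #|X| * ka by apply: Rmult_lt_0_compat.
have Xkan : 0 < (INR #|X| * ka) ^ n by apply: pow_lt.
have lX : 0 < la ^ k * / INR #|X| ^ n by apply: Rmult_lt_0_compat.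
have lP : ln P <= ln C + t * (INR k * ln la - INR n * R0) + INR n * (R0 + ln ka).
  apply: Rle_trans (ln_le P0 (Pb k n)) _; apply: Req_le.
  rewrite ln_mult //; last by apply: Rmult_lt_0_compat => //; apply: pw_gt0.
  rewrite ln_mult //; last exact: pw_gt0.
  rewrite ln_pw // ln_mult // ln_Rinv; last by apply: pow_lt.
  by rewrite !ln_pow // ln_mult // -/R0 -/t; ring.
have [k1 k2] : r * INR n - 1 <= INR k <= r * INR n.
  by apply: floor_nat_bounds; apply: Rmult_le_pos; lra.
have kla : INR k * ln la <= r * INR n * ln la + Rabs (ln la).
  by rewrite /Rabs; case: Rcase_abs => ?; nra.
have ts : t * (1 - s) = 1 by apply: Rinv_l; lra.
have lnka : ln ka <= t * (s * Hup Wc s).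
  have -> : ln ka = t * ((1 - s) * ln ka) by rewrite -Rmult_assoc ts; ring.
  by apply: Rmult_le_compat_l; lra.
pose U := r * ln la + s * Hup Wc s.
(* Since t(1-s) = 1, the terms -n t R0 from the codeword law and n R0 from the output sum combine to
   -n t s R0. *)
have main : ln P <= D + INR n * (t * (U - s * R0)).
  have h1 : t * (INR k * ln la) <= t * (r * INR n * ln la + Rabs (ln la)).
    by apply: Rmult_le_compat_l; lra.
  have h2 : INR n * ln ka <= INR n * (t * (s * Hup Wc s)).
    by apply: Rmult_le_compat_l; lra.
  have h3 : INR n * R0 = INR n * R0 * (t * (1 - s)) by rewrite ts; ring.
  by rewrite /D /U; nra.
have -> : (s * R0 - Uup Ws Wc r s) / (1 - s) = - (t * (U - s * R0)).
  by rewrite /Uup -/la /U /t; field; lra.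
apply: (Rmult_le_reg_l (INR n)) => //.
have -> : INR n * (- / INR n * ln P) = - ln P by field; lra.
by lra.
Qed.
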